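(* Let $d\geq 2$ be an integer. For every randomized online coloring algorithm $\mathcal{A}$ and every integer $n\geq 12d^2$, there exists an $n$-vertex chordal graph $G$ with chromatic number $\chi(G)=d$, presented by an oblivious adversary, such that the expected number of colors used by $\mathcal{A}$ to color $G$ is $\Omega(d\cdot\log n)$, with an absolute implicit constant.
   Context: Online graph coloring: the vertices of a graph arrive one at a time in an order chosen by an adversary; when a vertex arrives, its edges to previously presented vertices are revealed, and the algorithm must immediately and irrevocably assign it a color different from the colors of its already-presented neighbors. A randomized online algorithm may use random choices; an oblivious adversary fixes the graph and the presentation order in advance, without knowledge of the outcomes of the algorithm's random choices. The cost is the expected number of distinct colors used. A graph is chordal if every induced cycle on four or more vertices has a chord. *)

(* Defs.v *)
From HB Require Import structures.
From mathcomp Require Import all_boot all_order all_algebra all_fingroup.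
From mathcomp Require Import all_classical all_reals all_analysis.

Set Implicit Arguments.
Unset Strict Implicit.
Unset Printing Implicit Defensive.

Local Open Scope nat_scope.

Record sgraph (V : finType) := SGraph {
  adj :> rel V;
  adj_sym : symmetric adj;
  adj_irrefl : irreflexive adj }.

(* A chord of a cycle joins two of its vertices that are not consecutive on
   it. [ucycle] ranges over all cycles without repeated vertices. *)
Definition chordal (V : finType) (G : sgraph V) : Prop :=
  forall c : seq V, ucycle G c -> 4 <= size c ->
  exists x y : V,
    [/\ x \in c, y \in c, G x y, y != next c x & x != next c y].

Definition colorable (V : finType) (G : sgraph V) (k : nat) : bool :=
  [exists f : {ffun V -> 'I_k}, forall x, forall y, G x y ==> (f x != f y)].

Lemma colorable_card (V : finType) (G : sgraph V) : exists k, colorable G k.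
Proof.
exists #|V|; apply/existsP; exists [ffun x => enum_rank x].
apply/forallP=> x; apply/forallP=> y; apply/implyP=> Gxy; rewrite !ffunE.
by apply: contraTneq Gxy => /enum_rank_inj ->; rewrite adj_irrefl.
Qed.

Definition chromatic_number (V : finType) (G : sgraph V) : nat :=
  ex_minn (colorable_card G).

(* The presentation order is s : the vertex s t arrives at time t. What is
   known when it arrives is the list, for j = 0, ..., t, of the adjacencies of
   s j to the vertices s 0, ..., s (j - 1); vertex names are not revealed. *)
Definition revealed (n : nat) (G : sgraph 'I_n) (s : 'S_n) (t : 'I_n) :
    seq bitseq :=
  [seq [seq G (s i) (s j) | i : 'I_n <- enum 'I_n & i < j]
     | j : 'I_n <- enum 'I_n & j <= t].

(* A deterministic online algorithm. Its earlier color choices are functions of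
   prefixes of the revealed list, so they need not be passed as an argument. *)
Record online_alg := OnlineAlg {
  choose_color :> seq bitseq -> nat;
  choose_color_proper : forall (n : nat) (G : sgraph 'I_n) (s : 'S_n)
    (i t : 'I_n), i < t -> G (s i) (s t) ->
    choose_color (revealed G s t) != choose_color (revealed G s i) }.

Definition num_colors (A : online_alg) (n : nat) (G : sgraph 'I_n) (s : 'S_n) :
    nat :=
  size (undup [seq A (revealed G s t) | t <- enum 'I_n]).

(* The sample point fixes the outcomes of all random choices, and hence a
   deterministic online algorithm. *)
Record randomized_online_alg (R : realType) := RandomizedOnlineAlg {
  sample_display : measure_display;
  sample_space : measurableType sample_display;
  sample_prob : probability sample_space R;
  run :> sample_space -> online_alg;
  run_measurable : forall h : seq bitseq,
    measurable_fun [set: sample_space]%classic (fun w => run w h) }.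

Definition expected_colors (R : realType) (A : randomized_online_alg R)
    (n : nat) (G : sgraph 'I_n) (s : 'S_n) : \bar R :=
  expectation (sample_prob A) (fun w => (num_colors (A w) G s)%:R%R).

(* Main.v *)
(* Replace every vertex of a forest by a clique of h = d/2 vertices, a "unit";
   the result is chordal and 2h-colorable. The adversary keeps "bags" of units,
   pairwise in different trees. Let C and C' be the sets of colors on two bags B
   and B' built one after the other. A new unit u adjacent to all of B' receives
   a set U of h colors disjoint from C', so that
     |C \cup C'| + |C \cup U| >= |C| + |C'| + h.
   Hence, if C and C' both have expected size at least x, then one of the bags
   B \cup B' and B \cup {u} carries at least x + h/2 colors in expectation. The
   adversary knows the law of the algorithm and can therefore choose the better
   bag in advance. After k levels it has used fewer than 2^(k+1) units and forced
   h (k + 2) / 2 colors; k is about log_4 n, and n >= 12 d^2 leaves enough room. *)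

Require Import Defs.
From mathcomp Require Import all_boot all_order all_algebra all_fingroup.
From mathcomp Require Import all_classical all_reals all_analysis.
From mathcomp Require Import measurable_realfun zify lra.

Set Implicit Arguments.
Unset Strict Implicit.
Unset Printing Implicit Defensive.

Import Order.TTheory GRing.Theory Num.Theory.

Local Open Scope nat_scope.

(** * Blow-ups of forests and their chordality *)

(* [q] maps a vertex to its unit and [P] a unit to its parent unit, which arrives
   later; [P u = u] means that [u] is a root. *)
Definition blowup_adj (V : eqType) (q : V -> nat) (P : nat -> nat)
    (x y : V) : bool :=
  (x != y) && [|| q x == q y, P (q x) == q y | P (q y) == q x].

Lemma blowup_adj_sym (V : eqType) (q : V -> nat) (P : nat -> nat) :
  symmetric (blowup_adj q P).
Proof.
move=> x y; rewrite /blowup_adj eq_sym [q x == q y]eq_sym.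
by congr (_ && (_ || _)); exact: orbC.
Qed.

Lemma blowup_adj_irrefl (V : eqType) (q : V -> nat) (P : nat -> nat) :
  irreflexive (blowup_adj q P).
Proof. by move=> x; rewrite /blowup_adj eqxx. Qed.

Definition blowup (V : finType) (q : V -> nat) (P : nat -> nat) : sgraph V :=
  SGraph (blowup_adj_sym q P) (blowup_adj_irrefl q P).

(* A vertex in the least unit met by a cycle sees only its own unit and the parent
   unit, which together form a clique; so its two neighbors on the cycle are
   adjacent. *)
Lemma blowup_chordal (V : finType) (q : V -> nat) (P : nat -> nat) :
  (forall u, u <= P u) -> chordal (blowup q P).
Proof.
move=> leP c cyc sz.
have [x0 x0c] : exists x, x \in c.
  by case: c sz {cyc} => // x c _; exists x; rewrite mem_head.
case: (@arg_minnP _ x0 (mem c) q x0c) => x xc qmin.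
have [i p defp] := rot_to xc.
have Uc : uniq c by case/andP: cyc.
have mc y : (y \in rot i c) = (y \in c) by rewrite mem_rot.
have := cyc; rewrite -(rot_ucycle i).
case/andP; rewrite defp => cyc' U'.
have Gz : blowup_adj q P (prev (x :: p) x) x.
  by apply: prev_cycle cyc' _; rewrite mem_head.
have Gy : blowup_adj q P x (next (x :: p) x).
  by apply: next_cycle cyc' _; rewrite mem_head.
have nz := next_prev U' x.
have : 4 <= size (x :: p) by rewrite -defp size_rot.
have yc : next (x :: p) x \in c by rewrite -mc defp mem_next mem_head.
have zc : prev (x :: p) x \in c by rewrite -mc defp mem_prev mem_head.
move: Gy Gz nz yc zc; set z := prev _ _ => Gy Gz nz yc zc sz'.
have nextE v : next c v = next (x :: p) v by rewrite -defp next_rot.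
(* If [q x] is the parent of [q v], then [q v <= q x], and minimality of [q x] forces equality. *)
have qE v : v \in c -> blowup_adj q P x v -> q v = q x \/ q v = P (q x).
  move=> vc /andP[_ /or3P[/eqP->|/eqP->|/eqP e]]; [by left|by right|].
  left; apply/eqP; rewrite eqn_leq qmin ?andbT //.
  by rewrite -e leP.
(* As the cycle has at least four vertices, the two neighbors of [x] on it are distinct and not
   consecutive. *)
have [ynz [zny yNn]] : next (x :: p) x != z /\
   (z != next (x :: p) (next (x :: p) x)) /\ next (x :: p) x != next (x :: p) z.
  rewrite nz; case: p sz' U' {defp cyc' Gz zc Gy yc nextE} @z nz
    => [|y [|w [|v s]]] //= _.
  rewrite !inE !negb_or -!andbA => /and5P[xy xw xv xs /and5P[yw yv ys wv _]] nz.
  move: nz; set z := prev_at _ _ _ _.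
  rewrite eqxx [y == x]eq_sym (negbTE xy) eqxx => nz; split; last split => //.
  - apply: contraTneq isT => yz; move: nz; rewrite -yz eqxx.
    by rewrite eq_sym (negbTE xy) => /eqP; rewrite eq_sym (negbTE xw).
  - apply: contraTneq isT => zw; move: nz; rewrite zw.
    rewrite eq_sym (negbTE xw) eq_sym (negbTE yw) eqxx => /eqP.
    by rewrite eq_sym (negbTE xv).
exists (next (x :: p) x), z; rewrite !nextE; split=> //.
  rewrite /= /blowup_adj ynz /=.
  have [-> | ->] := qE _ yc Gy.
    by have [-> | ->] := qE _ zc (eq_trans (blowup_adj_sym _ _ _ _) Gz);
      rewrite eqxx ?orbT.
  by have [-> | ->] := qE _ zc (eq_trans (blowup_adj_sym _ _ _ _) Gz);
      rewrite eqxx ?orbT.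
Qed.

(** * Layout of the units in the order of arrival *)

(* The first [d] vertices form unit 0, a [d]-clique that makes the chromatic
   number [d]; units [1, 2, ...] have [h] vertices each. *)
Definition unit_of (d h i : nat) : nat :=
  if i < d then 0 else ((i - d) %/ h).+1.

(* Junk value at [u = 0]. *)
Definition unit_vertices (d h u : nat) : seq nat := iota (d + u.-1 * h) h.

Lemma unit_of_mono (d h i j : nat) : i <= j -> unit_of d h i <= unit_of d h j.
Proof.
rewrite /unit_of => ij; case: ifP => // /negbT; rewrite -leqNgt => di.
by rewrite [j < d]ltnNge (leq_trans di ij) /= ltnS leq_div2r // leq_sub2r.
Qed.

Lemma unit_of_unit_vertices (d h u t : nat) :
  0 < u -> t \in unit_vertices d h u -> unit_of d h t = u.
Proof.
rewrite /unit_vertices mem_iota => u0 /andP[le_t].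
rewrite -ltn_subLR // => lt_t.
have h0 : 0 < h by apply: leq_ltn_trans lt_t.
have dt : d <= t by apply: leq_trans le_t; apply: leq_addr.
rewrite /unit_of ltnNge dt /=.
have -> : t - d = u.-1 * h + (t - (d + u.-1 * h)).
  by rewrite subnDA subnKC // leq_subRL.
by rewrite divnMDl // divn_small ?addn0 ?prednK.
Qed.

(** * Histories seen by the algorithm *)

(** Free of [n], so that histories can be compared across forests before the final graph is
    fixed. *)
Definition revealed_nat (e : rel nat) (t : nat) : seq bitseq :=
  [seq [seq e i j | i <- iota 0 j] | j <- iota 0 t.+1].

Lemma map_filter_enum_ord (T : Type) (n : nat) (p : pred nat) (f : nat -> T) :
  [seq f (val i) | i : 'I_n <- enum 'I_n & p (val i)]
    = [seq f i | i <- iota 0 n & p i].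
Proof. by rewrite -val_enum_ord filter_map -map_comp. Qed.

Lemma revealed_id (n : nat) (G : sgraph 'I_n) (e : rel nat) (t : 'I_n) :
  (forall i j : 'I_n, G i j = e i j) -> revealed G 1%g t = revealed_nat e t.
Proof.
move=> Ge; rewrite /revealed /revealed_nat.
have -> : iota 0 t.+1 = [seq j <- iota 0 n | j <= t].
  exact: esym (filter_iota_leq 0 (ltn_ord t)).
rewrite -map_filter_enum_ord; apply: eq_map => j /=.
have -> : iota 0 j = [seq i <- iota 0 n | i < j].
  exact: esym (filter_iota_ltn 0 (ltnW (ltn_ord j))).
rewrite -map_filter_enum_ord; apply: eq_map => i /=.
by rewrite !perm1.
Qed.

(** Properness is only assumed on finite graphs; it is applied to the blow-up cut off after its last
    vertex [t]. *)
Lemma choose_color_blowup (a : online_alg) (q P : nat -> nat) (i t : nat) :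
  i < t -> blowup_adj q P i t ->
  a (revealed_nat (blowup_adj q P) t) != a (revealed_nat (blowup_adj q P) i).
Proof.
move=> it Gt.
pose G := blowup (fun x : 'I_t.+1 => q x) P.
have := @choose_color_proper a t.+1 G 1%g (inord i) ord_max.
have iv : (inord i : 'I_t.+1) = i :> nat by rewrite inordK // ltnS ltnW.
rewrite !(@revealed_id _ _ (blowup_adj q P)) // !perm1 /= iv.
by apply=> //; move: Gt; rewrite /blowup_adj -[in X in _ -> X]val_eqE /= iv.
Qed.

(** Unit numbers grow with time, so the history at [t] involves only units below [m]. Edges inside a
    unit do not depend on the forest, whence [u != v]: a root may receive a parent from [m] on
    without altering earlier histories. *)
Lemma revealed_nat_agree (q P P' : nat -> nat) (m t : nat) :
  {homo q : i j / i <= j} ->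
  (forall u v, u < m -> v < m -> u != v -> (P u == v) = (P' u == v)) ->
  q t < m ->
  revealed_nat (blowup_adj q P) t = revealed_nat (blowup_adj q P') t.
Proof.
move=> qm PP' tm; apply/eq_in_map => j; rewrite mem_iota ltnS /= => jt.
have jm : q j < m by apply: leq_ltn_trans (qm _ _ jt) tm.
apply/eq_in_map => i; rewrite mem_iota /= => ij.
have im : q i < m by apply: leq_ltn_trans (qm _ _ (ltnW ij)) jm.
congr (_ && _); case: eqVneq => //= qij.
by rewrite !PP' // eq_sym.
Qed.

(** * Colors on bags *)

(** A bag is recorded by histories instead of colors, since the same histories are fed to every
    deterministic algorithm in the mixture. *)
Definition bag_histories (d h : nat) (P : nat -> nat) (B : seq nat) :
    seq (seq bitseq) :=
  [seq revealed_nat (blowup_adj (unit_of d h) P) t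
     | t <- flatten [seq unit_vertices d h u | u <- B]].

Lemma bag_histories_cat (d h : nat) (P : nat -> nat) (B1 B2 : seq nat) :
  bag_histories d h P (B1 ++ B2)
    = bag_histories d h P B1 ++ bag_histories d h P B2.
Proof. by rewrite /bag_histories map_cat flatten_cat map_cat. Qed.

Lemma bag_histories_agree (d h m : nat) (P P' : nat -> nat) (B : seq nat) :
  (forall u v, u < m -> v < m -> u != v -> (P u == v) = (P' u == v)) ->
  {in B, forall b, 0 < b < m} ->
  bag_histories d h P B = bag_histories d h P' B.
Proof.
move=> PP' Bm; apply/eq_in_map => t /flatten_mapP[b bB tb].
have /andP[b0 bm] := Bm b bB.
apply: (revealed_nat_agree _ PP'); first exact: unit_of_mono.
by rewrite (unit_of_unit_vertices b0 tb).
Qed.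

Lemma bag_histories_unit_uniq (a : online_alg) (d h : nat) (P : nat -> nat)
    (u : nat) : 0 < u -> uniq [seq a x | x <- bag_histories d h P [:: u]].
Proof.
move=> u0; rewrite /bag_histories /= cats0 -map_comp map_inj_in_uniq ?iota_uniq //.
have key x y : x \in unit_vertices d h u -> y \in unit_vertices d h u -> x < y ->
    a (revealed_nat (blowup_adj (unit_of d h) P) y)
      != a (revealed_nat (blowup_adj (unit_of d h) P) x).
  move=> xu yu xy; apply: choose_color_blowup => //; rewrite /blowup_adj.
  by rewrite !(unit_of_unit_vertices u0) // eqxx andbT ltn_eqF.
move=> x y xu yu /= exy; apply/eqP; case: ltngtP => // xy.
  by move: (key _ _ xu yu xy); rewrite exy eqxx.
by move: (key _ _ yu xu xy); rewrite exy eqxx.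
Qed.

Lemma bag_histories_parent_disjoint (a : online_alg) (d h : nat)
    (P : nat -> nat) (u : nat) (B : seq nat) :
  {in B, forall b, 0 < b < u /\ P b = u} ->
  ~~ has (mem [seq a x | x <- bag_histories d h P B])
         [seq a x | x <- bag_histories d h P [:: u]].
Proof.
move=> BP; apply/hasPn => c; rewrite /bag_histories /= cats0.
case/mapP=> _ /mapP[t tu ->] ->; apply/mapP => -[_ /mapP[s sB ->]].
move/flatten_mapP: sB => [b bB sb]; have [/andP[b0 bu] Pb] := BP b bB.
have qs := unit_of_unit_vertices b0 sb.
have qt := unit_of_unit_vertices (ltn_trans b0 bu) tu.
have st : s < t.
  by rewrite ltnNge; apply/negP => /(@unit_of_mono d h); rewrite qs qt leqNgt bu.
apply/eqP; apply: choose_color_blowup => //; rewrite /blowup_adj.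
by rewrite qs qt Pb eqxx orbT andbT ltn_eqF.
Qed.

(** Since [s2] and [u] are disjoint, each color of [s1] is missing from at least one of them; hence
    the parts of [s1] outside [s2] and outside [u] together count at least all of [s1]. *)
Lemma size_undup_exchange (T : eqType) (s1 s2 u : seq T) :
  uniq u -> ~~ has (mem s2) u ->
  size (undup s1) + size (undup s2) + size u
    <= size (undup (s1 ++ s2)) + size (undup (s1 ++ u)).
Proof.
move=> Uu dj.
have szU (t : seq T) : size (undup (s1 ++ t))
    = size [seq x <- undup s1 | x \notin t] + size (undup t).
  by rewrite undup_cat size_cat.
rewrite !szU (undup_id Uu).
have : size (undup s1) <= size [seq x <- undup s1 | x \notin s2]
    + size [seq x <- undup s1 | x \notin u]; last by lia.
rewrite -size_cat; apply: uniq_leq_size; rewrite ?undup_uniq // => x xs1.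
rewrite mem_cat !mem_filter xs1 !andbT -negb_and; apply/negP => /andP[xs2 xu].
by move/hasPn: dj => /(_ x xu) /=; rewrite xs2.
Qed.

Definition num_distinct (hs : seq (seq bitseq)) (a : online_alg) : nat :=
  size (undup [seq a x | x <- hs]).

Lemma num_distinct_sub (hs hs' : seq (seq bitseq)) (a : online_alg) :
  {subset hs <= hs'} -> num_distinct hs a <= num_distinct hs' a.
Proof.
move=> sub; apply: uniq_leq_size (undup_uniq _) _ => c.
by rewrite !mem_undup => /mapP[x /sub xhs ->]; apply: map_f.
Qed.

(** * Chromatic number of the blow-up *)

(** Parents have larger numbers, so sides are assigned downward from [m], each unit taking the side
    opposite to its parent. *)
Lemma forest_bipartite (m : nat) (P : nat -> nat) :
  (forall u, u <= P u) -> (forall u, m <= u -> P u = u) ->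
  exists g : nat -> bool, forall u, P u != u -> g (P u) != g u.
Proof.
move=> leP Pid.
suff H k : k <= m -> exists g : nat -> bool,
    forall u, m - k <= u -> P u != u -> g (P u) != g u.
  by have [g gP] := H m (leqnn m); exists g => u; apply: gP; rewrite subnn.
elim: k => [_|k IH km].
  by exists xpred0 => u; rewrite subn0 => /Pid ->; rewrite eqxx.
have [g gP] := IH (ltnW km).
exists (fun u => if u == m - k.+1 then ~~ g (P u) else g u) => u mu uP.
have := leP u; rewrite leq_eqVlt eq_sym (negbTE uP) /= => ltu.
rewrite (gtn_eqF (leq_ltn_trans mu ltu)) /=.
by case: (eqVneq u (m - k.+1)) => [_|ne]; [case: (g _)|apply: gP => //; lia].
Qed.

(** Unit 0 is a [d]-clique, which gives the lower bound. For the upper bound it takes all [d]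
    colors, while any other unit takes the palette below [h] or the one from [h] to [2 * h],
    according to its side of the bipartition. *)
Lemma blowup_chromatic_number (n d h m : nat) (P : nat -> nat) :
  0 < h -> 2 * h <= d <= n ->
  (forall u, u <= P u) -> (forall u, m <= u -> P u = u) -> P 0 = 0 ->
  chromatic_number (blowup (fun i : 'I_n => unit_of d h i) P) = d.
Proof.
move=> h0 /andP[hd dn] leP Pid P0.
rewrite /chromatic_number; case: ex_minnP => k /existsP[f /forallP fP] kmin.
apply/eqP; rewrite eqn_leq; apply/andP; split.
  apply: kmin; apply/existsP.
  have [g gP] := forest_bipartite leP Pid.
  pose col i := if i < d then i else g (unit_of d h i) * h + (i - d) %% h.
  have col_lt i : col i < d.
    rewrite /col; case: ifP => // _.
    have := ltn_pmod (i - d) h0; case: (g _) => /=; lia.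
  exists [ffun i : 'I_n => Ordinal (col_lt i)].
  apply/forallP => x; apply/forallP => y; apply/implyP => /andP[xy adj].
  rewrite !ffunE -val_eqE /=; move: xy; rewrite -val_eqE /=.
  move: (val x) (val y) adj => {x y} /=.
  have colP i j : P (unit_of d h i) = unit_of d h j ->
      unit_of d h i != unit_of d h j -> col i != col j.
    move=> Pij nij; have := gP (unit_of d h i); rewrite Pij eq_sym.
    move=> /(_ nij) gij; rewrite /col.
    case: (ltnP i d) => di.
      by move: Pij nij; rewrite {1 3}/unit_of di P0 => <-.
    case: (ltnP j d) => dj.
      (* Unit 0 has no other unit as a child, because parents never have smaller numbers. *)
      move: (leP (unit_of d h i)); rewrite Pij {2}/unit_of dj leqn0.
      by rewrite /unit_of ltnNge di.
    have := ltn_pmod (i - d) h0; have := ltn_pmod (j - d) h0.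
    by move: gij; case: (g _); case: (g _) => //=; lia.
  move=> i j adj ij; have [qij|qij] := eqVneq (unit_of d h i) (unit_of d h j).
    rewrite /col qij; move: qij; rewrite /unit_of.
    case: (ltnP i d) => di; case: (ltnP j d) => dj //= -[qij].
    rewrite eqn_add2l; apply: contraNneq ij => mij; apply/eqP.
    by have := divn_eq (i - d) h; have := divn_eq (j - d) h; rewrite qij mij; lia.
  case/or3P: adj => /eqP e; first by rewrite e eqxx in qij.
    exact: colP.
  by rewrite eq_sym; apply: colP => //; rewrite eq_sym.
pose F (i : 'I_d) := f (widen_ord dn i).
suff injF : injective F by have := leq_card F injF; rewrite !card_ord.
move=> i j; rewrite /F => fij; apply/eqP/negPn/negP => ij.
have := fP (widen_ord dn i) => /forallP/(_ (widen_ord dn j))/implyP.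
rewrite fij eqxx /= /blowup_adj -val_eqE /= => H; suff: false by []; apply: H.
by rewrite /unit_of !ltn_ord val_eqE ij.
Qed.

(** * Measurability and expected numbers of colors *)

(** Split into countably many events by the first color [c]. The general [g] lets the induction
    absorb [c] into [fun s => g (c :: s)]. *)
Lemma measurable_run_seq (R : realType) (A : randomized_online_alg R)
    (hs : seq (seq bitseq)) (g : seq nat -> nat) :
  measurable_fun [set: sample_space A]%classic
    (fun w => g [seq A w x | x <- hs]).
Proof.
elim: hs g => [|x hs IH] g; first exact: (measurable_cst (g [::])).
move=> _ Y _; rewrite setTI.
rewrite (_ : (_ @^-1` _)%classic = (\bigcup_c ((fun w => A w x) @^-1` [set c]
   `&` (fun w => g (c :: [seq A w y | y <- hs])) @^-1` Y))%classic).
  apply: bigcupT_measurable => c; apply: measurableI.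
    rewrite -[X in measurable X]setTI; exact: (@run_measurable R A x measurableT [set c]%classic).
  rewrite -[X in measurable X]setTI.
  exact: (IH (fun s => g (c :: s)) measurableT).
apply/seteqP; split=> w /=; first by exists (A w x).
by case=> c _ /= [<-].
Qed.

Lemma measurable_num_distinct (R : realType) (A : randomized_online_alg R)
    (hs : seq (seq bitseq)) :
  measurable_fun [set: sample_space A]%classic
    (fun w => ((num_distinct hs (A w))%:R%:E : \bar R)).
Proof.
pose f (k : nat) : \bar R := (k%:R)%:E.
have mf : measurable_fun [set: nat]%classic f by move=> _ Y _.
apply: measurableT_comp mf _.
exact: (@measurable_run_seq R A hs (fun s => size (undup s))).
Qed.

Definition expected_distinct (R : realType) (A : randomized_online_alg R)
    (hs : seq (seq bitseq)) : \bar R :=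
  (\int[sample_prob A]_w (num_distinct hs (A w))%:R%:E)%E.

Lemma expected_distinct_sub (R : realType) (A : randomized_online_alg R)
    (hs hs' : seq (seq bitseq)) :
  {subset hs <= hs'} -> (expected_distinct A hs <= expected_distinct A hs')%E.
Proof.
move=> sub; apply: ge0_le_integral => //; try exact: measurable_num_distinct.
by move=> w _; rewrite lee_fin ler_nat num_distinct_sub.
Qed.

Lemma expected_distinct_ge (R : realType) (A : randomized_online_alg R)
    (hs : seq (seq bitseq)) (k : nat) :
  (forall a : online_alg, k <= num_distinct hs a) ->
  (k%:R%:E <= expected_distinct A hs)%E.
Proof.
move=> le_k.
have -> : (k%:R%:E : \bar R)
    = (\int[sample_prob A]_(w in [set: sample_space A]) cst k%:R%:E w)%E.
  by rewrite integral_cst //= probability_setT mule1.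
apply: ge0_le_integral => //; last by move=> w _; rewrite lee_fin ler_nat.
- by move=> w _; rewrite lee_fin ler0n.
- exact: measurable_num_distinct.
Qed.

Lemma expected_distinct_exchange (R : realType) (A : randomized_online_alg R)
    (hs1 hs2 hsu : seq (seq bitseq)) :
  (forall a : online_alg, uniq [seq a x | x <- hsu] /\
    ~~ has (mem [seq a x | x <- hs2]) [seq a x | x <- hsu]) ->
  (expected_distinct A hs1 + expected_distinct A hs2 + (size hsu)%:R%:E
    <= expected_distinct A (hs1 ++ hs2) + expected_distinct A (hs1 ++ hsu))%E.
Proof.
move=> Hu; rewrite /expected_distinct.
have -> : ((size hsu)%:R%:E : \bar R)
   = (\int[sample_prob A]_(w in [set: sample_space A]) cst (size hsu)%:R%:E w)%E.
  by rewrite integral_cst //= probability_setT mule1.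
have nneg hs (w : sample_space A) :
    [set: sample_space A]%classic w -> (0 <= (num_distinct hs (A w))%:R%:E :> \bar R)%E.
  by move=> _; rewrite lee_fin ler0n.
have mD hs := @measurable_num_distinct R A hs.
rewrite -!ge0_integralD //.
- apply: ge0_le_integral => //.
  + by move=> w _; rewrite !adde_ge0 // lee_fin ler0n.
  + by apply: emeasurable_funD => //; apply: emeasurable_funD.
  + by apply: emeasurable_funD.
  + move=> w _; rewrite -!EFinD lee_fin -!natrD ler_nat.
    have [Uu dj] := Hu (A w).
    rewrite /num_distinct !map_cat -(size_map (A w) hsu).
    exact: size_undup_exchange.
- by move=> w _; rewrite adde_ge0 // lee_fin ler0n.
- exact: emeasurable_funD.
- by move=> w _; rewrite lee_fin ler0n.
Qed.

(** * The recursive adversary *)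

(** The recursion only adds units from [m] on, leaving older parents alone, and keeps the units of
    [B] as roots so that they can still be given a parent. Level 0 is a single unit with [h] colors;
    each level gains [h / 2]. *)
Lemma forest_adversary (R : realType) (A : randomized_online_alg R)
    (d h k m : nat) (P : nat -> nat) :
  0 < m -> (forall u, u <= P u) -> (forall u, m <= u -> P u = u) ->
  exists (P' : nat -> nat) (m' : nat) (B : seq nat),
    [/\ m <= m' < m + 2 ^ k.+1,
        (forall u, u <= P' u) /\ (forall u, m' <= u -> P' u = u),
        forall u, u < m -> P' u = P u,
        {in B, forall b, m <= b < m' /\ P' b = b} &
        ((h%:R * k.+2%:R / 2%:R)%:E
           <= expected_distinct A (bag_histories d h P' B))%E].
Proof.
elim: k m P => [|k IH] m P m0 PgeP Pid.
  exists P, m.+1, [:: m]; split=> //.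
  - by rewrite leqnSn expn1 addn2 /=.
  - by split=> // u mu; apply: Pid; apply: ltnW.
  - by move=> b; rewrite inE => /eqP ->; rewrite leqnn ltnSn Pid.
  - rewrite mulfK ?pnatr_eq0 //; apply: expected_distinct_ge => a.
    rewrite /num_distinct undup_id ?bag_histories_unit_uniq //.
    by rewrite !size_map /= cats0 size_iota.
have [P1 [m1 [B1 [/andP[mm1 lt1] [leP1 Pid1] ext1 BP1 E1]]]] := IH m P m0 PgeP Pid.
have [P2 [m2 [B2 [/andP[mm2 lt2] [leP2 Pid2] ext2 BP2 E2]]]] :=
  IH m1 P1 (leq_trans m0 mm1) leP1 Pid1.
have m20 : 0 < m2 by rewrite (leq_trans m0) // (leq_trans mm1).
(* The new unit [m2] becomes the parent of every root in [B2]. *)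
pose P3 u := if u \in B2 then m2 else P2 u.
have P3lt u : u < m1 -> P3 u = P2 u.
  rewrite /P3; case: ifP => // uB um.
  by have [/andP[]] := BP2 u uB; rewrite leqNgt um.
have agree23 u v : u < m2 -> v < m2 -> u != v -> (P2 u == v) = (P3 u == v).
  move=> um vm uv; rewrite /P3; case: ifP => // uB.
  by have [_ ->] := BP2 u uB; rewrite (negbTE uv) gtn_eqF.
have agree12 u v : u < m1 -> v < m1 -> u != v -> (P1 u == v) = (P2 u == v).
  by move=> um _ _; rewrite ext2.
have B1m1 : {in B1, forall b, 0 < b < m1}.
  by move=> b /BP1[/andP[mb bm] _]; rewrite bm (leq_trans m0).
have B1m2 : {in B1, forall b, 0 < b < m2}.
  by move=> b /B1m1/andP[-> bm]; rewrite (leq_trans bm).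
have B2m2 : {in B2, forall b, 0 < b < m2}.
  by move=> b /BP2[/andP[mb ->] _]; rewrite (leq_trans _ mb) // (leq_trans m0).
(* The exchange inequality is stated in [P3], but the first alternative below keeps [P2]; bags below
   [m2] cannot tell them apart. *)
have eB12 : bag_histories d h P3 (B1 ++ B2) = bag_histories d h P2 (B1 ++ B2).
  apply/esym/(bag_histories_agree d h agree23) => b.
  by rewrite mem_cat => /orP[/B1m2|/B2m2].
have Hu (a : online_alg) :
    uniq [seq a x | x <- bag_histories d h P3 [:: m2]] /\
    ~~ has (mem [seq a x | x <- bag_histories d h P3 B2])
      [seq a x | x <- bag_histories d h P3 [:: m2]].
  split; first exact: bag_histories_unit_uniq.
  apply: bag_histories_parent_disjoint => b bB; split; first exact: B2m2.
  by rewrite /P3 bB.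
have Ex := expected_distinct_exchange A (bag_histories d h P3 B1) Hu.
move: Ex; rewrite -!bag_histories_cat eB12.
have -> : size (bag_histories d h P3 [:: m2]) = h.
  by rewrite size_map /= cats0 size_iota.
rewrite -(bag_histories_agree d h agree23 B1m2).
rewrite -(bag_histories_agree d h agree23 B2m2).
rewrite -(bag_histories_agree d h agree12 B1m1) => Ex.
set x : R := (h%:R * k.+2%:R / 2%:R)%R in E1 E2.
set y : R := (h%:R * k.+3%:R / 2%:R)%R.
have xy : (x + x + h%:R = y + y)%R.
  rewrite /x /y -[k.+3%:R%R]natr1; lra.
(* The two candidate bags total at least [x + x + h = y + y] in expectation, so one of them reaches
   [y]. *)
have [le0|lt0] := leP y%:E (expected_distinct A (bag_histories d h P2 (B1 ++ B2))).
  exists P2, m2, (B1 ++ B2); split=> //.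
  - by rewrite (leq_trans mm1) //= expnS; lia.
  - by move=> u um; rewrite ext2 ?ext1 // (leq_trans um).
  - move=> b; rewrite mem_cat => /orP[bB|bB].
      have [/andP[mb bm] Pb] := BP1 b bB.
      by rewrite mb (leq_trans bm) // ext2.
    by have [/andP[mb ->] Pb] := BP2 b bB; rewrite (leq_trans mm1).
exists P3, m2.+1, (B1 ++ [:: m2]); split=> //.
(* Two recursive calls and one extra unit: at most [2 * (2 ^ k.+1 - 1) + 1 = 2 ^ k.+2 - 1] new
   units. *)
- by rewrite (leq_trans mm1) ?leqW //= expnS; lia.
- split=> u.
    rewrite /P3; case: ifP => // uB.
    by have [/andP[_ /ltnW]] := BP2 u uB.
  move=> um; rewrite /P3; case: ifP => uB; last by rewrite Pid2 // ltnW.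
  by have [/andP[_]] := BP2 u uB; rewrite ltnNge ltnW.
- by move=> u um; rewrite P3lt ?ext2 ?ext1 // (leq_trans um).
- move=> b; rewrite mem_cat inE => /orP[bB|/eqP->].
    have [/andP[mb bm] Pb] := BP1 b bB.
    by rewrite mb P3lt // ltnS ltnW ?(leq_trans bm) // ext2.
  rewrite (leq_trans mm1) //= ltnSn; split=> //; rewrite /P3; case: ifP => //.
  by rewrite Pid2.
- rewrite leNgt; apply/negP => lt1'.
  have := lteD lt0 lt1'; rewrite -EFinD -xy ltNge => /negP; apply.
  by apply: le_trans Ex; rewrite !EFinD leeD2r // leeD.
Qed.

(** * Choice of parameters and the lower bound *)

Lemma expected_colorsE (R : realType) (A : randomized_online_alg R) (n : nat)
    (G : sgraph 'I_n) (s : 'S_n) :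
  expected_colors A G s
    = expected_distinct A [seq revealed G s t | t <- enum 'I_n].
Proof.
rewrite /expected_colors unlock; apply: eq_integral => w _.
by rewrite /num_colors /num_distinct -map_comp.
Qed.

(** With [x = 2 ^ L], AM-GM gives [x * h <= d * x / 2 <= (d ^ 2 + x ^ 2) / 4], and both squares are
    controlled by [n]. *)
Lemma blowup_fits (d h L n : nat) :
  2 * h <= d -> 2 <= d -> 12 * d ^ 2 <= n -> 4 ^ L <= n -> d + 2 ^ L * h <= n.
Proof.
rewrite (expnMn 2 2) -mulnn; move: (2 ^ L) => x hd d2 dn xn.
have amgm : 2 * (d * x) <= d * d + x * x.
  by rewrite !mulnn; case: (nat_Cauchy d x).
have hx : 2 * (x * h) <= d * x by rewrite mulnCA mulnC leq_mul2r hd orbT.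
have dd : 2 * d <= d * d by rewrite leq_mul2r d2 orbT.
lia.
Qed.

Theorem theorem2 (R : realType) :
  exists c : R, (0 < c)%R /\
    forall d : nat, 2 <= d ->
    forall (A : randomized_online_alg R) (n : nat), 12 * d ^ 2 <= n ->
    exists (G : sgraph 'I_n) (s : 'S_n),
      [/\ chordal G,
          chromatic_number G = d &
          ((c * d%:R * ln n%:R)%:E <= expected_colors A G s)%E].
Proof.
have ln4 : (0 < ln 4 :> R)%R by rewrite ln_gt0 // ltr1n.
(* From [d <= 3 * h] and [ln n <= ln 4 * (L + 1)], the product [d * ln n] is at most [6 * ln 4]
   times the forced [h * (L + 1) / 2]. *)
exists ((6 * ln 4)^-1)%R; split; first by rewrite invr_gt0 mulr_gt0.
move=> d d2 A n dn.
have n4 : 4 <= n by rewrite (leq_trans _ dn) //; have := leq_mul d2 d2; lia.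
pose h := d./2; pose L := trunc_log 4 n.
have hd : 2 * h <= d by rewrite /h; lia.
have h3 : d <= 3 * h by rewrite /h; lia.
have h0 : 0 < h by lia.
have L0 : 0 < L by rewrite /L trunc_log_gt0.
have fits := blowup_fits hd d2 dn (trunc_logP (isT : 1 < 4) (ltnW (ltnW (ltnW n4)))).
(* Unit 0 is reserved for the clique, so the recursion starts at unit 1; depth [L.-1] keeps
   [m <= 2 ^ L], the room provided by [fits]. *)
have [P [m [B [/andP[m0 mL] [leP Pid] ext BP EB]]]] :=
  @forest_adversary R A d h L.-1 1 id isT (fun=> leqnn _) (fun _ _ => erefl).
move: mL EB; rewrite prednK // => mL EB.
have d_le_n : d <= n by apply: leq_trans fits; apply: leq_addr.
pose G := blowup (fun i : 'I_n => unit_of d h i) P.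
exists G, 1%g; split.
- exact: blowup_chordal.
- by apply: (blowup_chromatic_number h0 _ leP Pid (ext 0 isT)); rewrite hd.
rewrite expected_colorsE.
have sub : {subset bag_histories d h P B
    <= [seq revealed G 1%g t | t <- enum 'I_n]}.
  move=> _ /mapP[t /flatten_mapP[b bB tb] ->].
  have [/andP[b0 bm] _] := BP b bB.
  have tn : t < n.
    move: tb; rewrite mem_iota => /andP[_ tb]; apply: leq_trans tb _.
    apply: leq_trans fits; rewrite -addnA leq_add2l -mulSnr prednK //.
    by rewrite leq_mul2r (leq_trans (ltnW bm)) ?orbT.
  apply/mapP; exists (Ordinal tn); first by rewrite mem_enum.
  by rewrite (@revealed_id _ _ (blowup_adj (unit_of d h) P)).
apply: le_trans (expected_distinct_sub A sub); apply: le_trans EB.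
rewrite lee_fin.
have lnn : (ln n%:R <= ln 4 * L.+1%:R :> R)%R.
  rewrite mulr_natr -lnXn // ler_ln ?posrE ?exprn_gt0 ?ltr0n //; last lia.
  by rewrite -natrX ler_nat ltnW // trunc_log_ltn.
have d3 : (d%:R <= 3 * h%:R :> R)%R by rewrite -natrM ler_nat.
rewrite -mulrA mulrC ler_pdivrMr ?mulr_gt0 //.
apply: le_trans (_ : 3 * h%:R * (ln 4 * L.+1%:R) <= _)%R.
  by apply: ler_pM => //; rewrite ln_ge0 // ler1n; lia.
lra.
Qed.
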